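(* Let $D$ be an $A$-adequate connected link diagram, and write the Jones polynomial of (the link represented by) $D$ as $V_D=V_0t^{k}+V_1t^{k+1}+\dots+V_dt^{k+d}$ with $V_0\neq 0\neq V_d$. Then $V_0=\pm 1$, $V_1V_0\le 0$, and $$|V_1|=e(G(A(D))')-v(G(A(D))')+1=b_1(G(A(D))')$$ is the first Betti number of the reduced $A$-graph $G(A(D))'$ of $D$.
   Context: The Jones polynomial is $V_D(t)=(-t^{-3/4})^{-w(D)}\langle D\rangle|_{A=t^{-1/4}}$, where $w(D)$ is the writhe and the Kauffman bracket $\langle D\rangle$ is the sum over all states $S$ (a choice of $A$- or $B$-splicing at each crossing) of $A^{\#A(S)-\#B(S)}(-A^2-A^{-2})^{|S|-1}$, with $\#A(S),\#B(S)$ the numbers of $A$- and $B$-splicings and $|S|$ the number of loops of $S$. The $A$-corners of a crossing are the two corners passed by the overcrossing strand when rotated counterclockwise towards the undercrossing strand; the $A$-splicing joins the two $A$-corners. The exponent $k$ may be a half-integer; $V_1$ is the coefficient of $t^{k+1}$ (zero if $d<1$). The $A$-state $A(D)$ is the state with all crossings $A$-spliced, together with, for each crossing, a ''trace'': an arc joining the loop(s) at the spliced spot. The $A$-graph $G(A(D))$ has one vertex for each loop of $A(D)$ and one edge for each crossing, joining the (vertices of the) loops at the two ends of its trace. $D$ is $A$-adequate if $G(A(D))$ has no edge connecting a vertex to itself. For a graph $G$, its reduction $G'$ is obtained by replacing every multiple edge by a simple edge; $v(G)$, $e(G)$ are the numbers of vertices and edges. *)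

(* Defs.v *)
From HB Require Import structures.
From mathcomp Require Import all_boot all_order all_algebra.

Set Implicit Arguments.
Unset Strict Implicit.
Unset Printing Implicit Defensive.

Import Order.TTheory GRing.Theory Num.Theory.
Local Open Scope ring_scope.

(* A link diagram on the sphere is encoded by its combinatorial map.
   A dart (c, i) is one of the four strand ends at the crossing c, numbered
   counterclockwise by i : 'I_4 (addition on 'I_4 is modulo 4), so that the
   ends 0, 2 belong to the undercrossing strand and the ends 1, 3 to the
   overcrossing strand.  The involution [arc] exchanges the two darts of each
   arc of the diagram between consecutive crossings.  Components without
   crossings are not visible on darts and are counted by [circles]. *)

Definition dart (C : finType) : finType := (C * 'I_4)%type.

Definition ccw (C : finType) (x : dart C) : dart C := (x.1, x.2 + 1).

Section Map.
Variables (C : finType) (arc : dart C -> dart C).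

(* The orbits of [face] are the boundary walks of the regions. *)
Definition face (x : dart C) : dart C := ccw (arc x).

Definition map_link : rel (dart C) := [rel x y | (y == arc x) || (y == ccw x)].

Definition map_components : nat := n_comp map_link predT.

(* Genus 0.  Each component has Euler characteristic at most 2, so for a
   disconnected map this forces every component to be spherical. *)
Definition euler_planar : Prop :=
  (#|C| + fcard face predT = fcard arc predT + 2 * map_components)%N.

End Map.

Record link_diagram := LinkDiagram {
  crossing : finType;
  arc : dart crossing -> dart crossing;
  arcK : involutive arc;
  arc_neq : forall x, arc x != x;
  arc_planar : euler_planar arc;
  circles : nat
}.

Definition diagram_connected (D : link_diagram) : Prop :=
  (map_components (@arc D) + circles D = 1)%N.

(* [out x] means that the strand leaves the crossing x.1 through x. *)
Record orientation (D : link_diagram) := Orientation {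
  out : pred (dart (crossing D));
  out_arc : forall x, out (arc x) = ~~ out x;
  out_through : forall x, out (ccw (ccw x)) = ~~ out x
}.

(* A crossing is positive when turning the outgoing end of the overcrossing
   strand counterclockwise by one corner gives the outgoing end of the
   undercrossing strand: the outgoing ends are then 1, 2 or 3, 0. *)
Definition crossing_sign (D : link_diagram) (o : orientation D)
    (c : crossing D) : int :=
  if out o (c, 1) == out o (c, 2) then 1 else -1.

Definition writhe (D : link_diagram) (o : orientation D) : int :=
  \sum_(c : crossing D) crossing_sign o c.

(* The A-corners are those between the ends 1, 2 and between 3, 0.  Joining
   them into one region connects the end 0 to 1 and the end 2 to 3. *)
Definition A_splice (i : 'I_4) : 'I_4 := if odd i then i - 1 else i + 1.

Definition B_splice (i : 'I_4) : 'I_4 := if odd i then i + 1 else i - 1.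

Section States.
Variable D : link_diagram.

(* A state is the set of its A-spliced crossings. *)
Definition state : Type := {set crossing D}.

Implicit Types (S : state) (x : dart (crossing D)).

Definition splice S x : dart (crossing D) :=
  (x.1, if x.1 \in S then A_splice x.2 else B_splice x.2).

Definition state_link S : rel (dart (crossing D)) :=
  [rel x y | (y == arc x) || (y == splice S x)].

Definition dart_loop S x : {set dart (crossing D)} :=
  [set y | connect (state_link S) x y].

Definition dart_loops S : {set {set dart (crossing D)}} :=
  [set dart_loop S x | x in [set: dart (crossing D)]].

Definition loop S : finType :=
  ({L : {set dart (crossing D)} | L \in dart_loops S} + 'I_(circles D))%type.

Lemma dart_loopP S x : dart_loop S x \in dart_loops S.
Proof. exact: imset_f. Qed.

Definition loop_of S x : loop S :=
  inl (exist (fun L => L \in dart_loops S) (dart_loop S x) (dart_loopP S x)).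

Definition A_state : state := [set: crossing D].

Definition kauffman_bracket (F : fieldType) (A : F) : F :=
  \sum_(S : state)
    A ^ (#|S|%:Z - #|~: S|%:Z) * (- A ^+ 2 - A ^- 2) ^+ (#|loop S|.-1).

End States.

(* Laurent polynomials in t^(1/4) are regarded as rational functions of it. *)
Definition ratfun : fieldType := {fraction {poly int}}.

Definition t_quarter : ratfun := tofrac ('X : {poly int}).

Definition t_half : ratfun := t_quarter ^+ 2.

Definition jones (D : link_diagram) (o : orientation D) : ratfun :=
  (- t_quarter ^- 3) ^ (- writhe o) * kauffman_bracket D t_quarter^-1.

(* Finite undirected graphs, loops and multiple edges allowed.  The naming of
   the two ends of an edge as [src] and [tgt] is arbitrary. *)
Record multigraph := Multigraph {
  vertex : finType;
  edge : finType;
  src : edge -> vertex;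
  tgt : edge -> vertex
}.

Definition loopless (G : multigraph) : Prop :=
  forall e : edge G, src e != tgt e.

Definition parallel (G : multigraph) : rel (edge G) :=
  [rel e f | ((src e == src f) && (tgt e == tgt f))
          || ((src e == tgt f) && (tgt e == src f))].

(* From each class of parallel edges, only the first one is kept. *)
Definition kept_edge (G : multigraph) (e : edge G) : bool :=
  [forall f : edge G, parallel e f ==> (enum_rank e <= enum_rank f)%N].

Definition reduction (G : multigraph) : multigraph :=
  @Multigraph (vertex G) {e : edge G | kept_edge e}
    (fun e => src (val e)) (fun e => tgt (val e)).

(* The cellular boundary map C_1 -> C_0, acting on row vectors. *)
Definition boundary (G : multigraph) : 'M[rat]_(#|edge G|, #|vertex G|) :=
  \matrix_(i, j) ((tgt (enum_val i) == enum_val j)%:R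
                  - (src (enum_val i) == enum_val j)%:R).

(* H_1 is the kernel of the boundary map, as there are no 2-cells. *)
Definition betti1 (G : multigraph) : nat := \rank (kermx (boundary G)).

(* The trace of c joins the arc through the ends 0, 1 to the one through
   the ends 2, 3. *)
Definition A_graph (D : link_diagram) : multigraph :=
  @Multigraph (loop (A_state D)) (crossing D)
    (fun c => loop_of (A_state D) (c, 0))
    (fun c => loop_of (A_state D) (c, 2)).

Definition A_adequate (D : link_diagram) : Prop := loopless (A_graph D).

(* Main.v *)
Require Import Defs.
From mathcomp Require Import all_boot all_order all_algebra.
From mathcomp Require Import all_fingroup zify ring.
Import Order.TTheory GRing.Theory Num.Theory.

(** Sort the state sum by the set [T] of B-spliced crossings, and let [v] be the
    number of loops of the A-state.  Changing the splicing at one crossing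
    merges two loops or splits one ([loops_toggle]).  If [merges T] of the
    changes leading from the A-state to [T] are mergers, the state has
    [v + #|T| - 2 * merges T] loops, and up to a unit common to all states it
    contributes [(-1)^(l-1) * t^(merges T) * (1 + t)^(l-1)], where [l] is this
    number of loops ([state_weight]).  So only the sets with [merges T <= 1]
    matter for the first two coefficients.

    If the diagram is A-adequate, the first change is always a merger, so that
    [merges T = 0] holds for the empty set only, and the first coefficient is
    [(-1)^(v-1)].  After a change at [e], an edge that is not parallel to [e] in
    the A-graph still joins two different loops ([merge_nonparallel]), while a
    parallel one does not ([parallel_touches]).  Hence [merges T = 1] holds
    exactly for the nonempty sets of mutually parallel edges.  The signs of the
    nonempty subsets of a parallel class add up to -1 ([sum_signs_cliques]), and
    the A-state adds [v - 1], so that the second coefficient is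
    [(-1)^(v-1) * (v - 1 - e)] with [e] the number of edges of the reduced
    A-graph.  As this graph is connected ([A_graph_connected]), [e - v + 1] is
    its first Betti number, and in particular it is not negative.

    Planarity enters through the vanishing of the first cohomology of the sphere
    modulo two ([cocycle_coboundary]), which is derived from the Euler
    inequality for permutations ([euler_inequality]) applied to a double cover.
    It gives the checkerboard colouring, which orients all loops of all states
    and so makes a change of splicing act as a transposition.  It also makes
    each loop of a state a Jordan curve: two loops cannot be joined by traces on
    both sides of one of them ([separating_coloring]), which is what forces
    parallel edges to lie side by side like the rungs of a ladder. *)

Set Implicit Arguments.
Unset Strict Implicit.
Unset Printing Implicit Defensive.

(** * Orbits of permutations and the Euler inequality *)

Section Orbits.
Variable T : finType.
Implicit Types (e : rel T) (s t : {perm T}).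

Lemma connect_invariant (A : Type) (phi : T -> A) e :
  (forall x y, e x y -> phi x = phi y) ->
  forall x y, connect e x y -> phi x = phi y.
Proof.
move=> ephi x y /connectP[p ep ->].
by elim: p x ep => //= z p IHp x /andP[/ephi-> /IHp].
Qed.

Lemma n_comp_card_classes e : connect_sym e ->
  n_comp e predT = #|[set [set y | connect e x y] | x in T]|.
Proof.
move=> symE; transitivity #|[set [set y | connect e x y] | x in roots e]|.
  rewrite card_in_imset => [|x y /eqP rx /eqP ry /setP/(_ y)].
    by apply: eq_card => x; rewrite !inE andbT.
  by rewrite !inE connect0 => /(fingraph.rootP symE); rewrite rx ry.
apply: eq_card => L; apply/imsetP/imsetP=> [[x xe ->] | [x _ ->]].
  by exists x.
exists (fingraph.root e x); first exact: (roots_root symE).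
apply/setP=> y; rewrite !inE; apply: same_connect => //.
exact: connect_root.
Qed.

Lemma mem_porbitE s x y : (y \in porbit s x) = fconnect s x y.
Proof.
apply/porbitP/idP=> [[i ->] | /iter_findex<-];
  first by rewrite permX fconnect_iter.
by exists (findex s x y); rewrite permX.
Qed.

Lemma card_porbits_fcard s : #|porbits s| = fcard s predT.
Proof.
rewrite n_comp_card_classes; last exact/fconnect_sym/perm_inj.
congr #|pred_of_set _|; apply: eq_imset => x.
by apply/setP=> y; rewrite inE mem_porbitE.
Qed.

Lemma n_comp_connect_same e1 e2 : connect_sym e1 -> connect_sym e2 ->
    (forall x y, e1 x y -> connect e2 x y) ->
    (forall x y, e2 x y -> connect e1 x y) ->
  n_comp e1 predT = n_comp e2 predT.
Proof.
move=> sym1 sym2 le12 le21; apply: eq_n_comp => x y.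
by apply/idP/idP; apply: connect_sub.
Qed.

(** Identifying the components of [a] and [b] loses at most one component. *)
Lemma n_comp_add_edge e1 e2 a b : connect_sym e1 -> connect_sym e2 ->
    (forall x y, e1 x y ->
      [|| connect e2 x y, connect e2 a x && connect e2 b y
        | connect e2 b x && connect e2 a y]) ->
  n_comp e2 predT <= (n_comp e1 predT).+1.
Proof.
move=> sym1 sym2 le12.
have le12' x y : connect e1 x y ->
  connect e2 x y || (connect e2 a x || connect e2 b x) &&
                    (connect e2 a y || connect e2 b y).
  move=> /connectP[p ep ->] {y}.
  elim: p x ep => /= [|z p IHp] x; first by rewrite connect0.
  case/andP=> /le12 xz /IHp; move: (last z p) => y zy.
  have E u v w : connect e2 u v -> connect e2 w u = connect e2 w v.
    by move=> uv; rewrite (same_connect_r sym2 uv).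
  case/or3P: xz => [xz | /andP[ax bz] | /andP[bx az]].
  - by rewrite (same_connect sym2 xz) !(E _ _ _ xz).
  - rewrite ax /=; case/orP: zy => [zy | /andP[_ ->]]; last by rewrite orbT.
    by rewrite -!(E z y _ zy) bz !orbT.
  - rewrite bx /= orbT /=; case/orP: zy => [zy | /andP[_ ->]];
    last by rewrite orbT.
    by rewrite -!(E z y _ zy) az !orbT.
rewrite /n_comp_mem (cardD1 (fingraph.root e2 a)) -ltnS.
set X := [predD1 _ & _].
apply: (@leq_trans #|X|.+2); first by case: (_ \in _).
rewrite !ltnS -(card_in_imset (f := fingraph.root e1) (D := X)).
  apply: subset_leq_card; apply/subsetP=> _ /imsetP[x _ ->].
  by rewrite !inE (roots_root sym1).
move=> x y; rewrite !inE !andbT =>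
  /andP[xa rx] /andP[ya ry] /(fingraph.rootP sym1)/le12'.
rewrite -[in RHS](eqP ry) -[in LHS](eqP rx).
have N z : z != fingraph.root e2 a -> roots e2 z -> ~~ connect e2 a z.
  move=> za rz; apply: contra za => /(fingraph.rootP sym2) ->.
  by rewrite (eqP rz).
rewrite (negPf (N _ xa rx)) (negPf (N _ ya ry)) /=.
by case/orP => [/(fingraph.rootP sym2) | /andP[/(fingraph.rootP sym2)<-
  /(fingraph.rootP sym2)]].
Qed.

Definition perms_link s t : rel T := [rel x y | (y == s x) || (y == t x)].

Lemma two_maps_sym (f g : T -> T) : injective f -> injective g ->
  connect_sym [rel x y | (y == f x) || (y == g x)].
Proof.
have sym1 (u : T -> T) : injective u -> connect_sym [rel x y | y == u x].
  move=> injU x y; rewrite !(@eq_connect _ _ (frel u)) => [|z w /=|z w /=];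
    last 2 first.
  - by rewrite eq_sym.
  - by rewrite eq_sym.
  exact/fconnect_sym.
by move=> /sym1 symf /sym1 symg; apply: (relU_sym symf symg).
Qed.

Lemma perms_link_sym s t : connect_sym (perms_link s t).
Proof. by apply: two_maps_sym; apply: perm_inj. Qed.

Lemma n_comp_le1P e : connect_sym e ->
  reflect (forall x y, connect e x y) (n_comp e predT <= 1).
Proof.
move=> symE; apply: (iffP card_le1_eqP) => [root1 x y | all_e x y].
  by apply/(fingraph.rootP symE)/root1; rewrite !inE (roots_root symE).
by rewrite !inE !andbT => /eqP<- /eqP<-; apply/(fingraph.rootP symE).
Qed.

Lemma perms_linkl s t x : connect (perms_link s t) x (s x).
Proof. by apply: connect1; rewrite /perms_link /= eqxx. Qed.

Lemma perms_linkr s t x : connect (perms_link s t) x (t x).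
Proof. by apply: connect1; rewrite /perms_link /= eqxx orbT. Qed.

Lemma connect_porbit_mul s t x y :
  y \in porbit (s * t) x -> connect (perms_link s t) x y.
Proof.
rewrite mem_porbitE; apply: connect_sub => {x y} x _ /eqP <-.
by rewrite permM; apply: connect_trans (perms_linkl s t x) (perms_linkr s t _).
Qed.

(** The genus of a combinatorial map is nonnegative.  The induction strips
    transpositions off [s] until it is the identity, where both sides agree.
    Each one changes the number of orbits of [s * t] by one; when it splits an
    orbit of [s' * t], the two points were already linked, so that the number
    of components does not change. *)
Lemma euler_inequality s t :
  #|porbits s| + #|porbits t| + #|porbits (s * t)|
    <= #|T| + 2 * n_comp (perms_link s t) predT.
Proof.
have [n] := ubnP (#|T| - #|porbits s|); elim: n s => // n IHn s.
have [/existsP[y sy] le_n | /existsPn s1 _] := boolP [exists y, s y != y];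
  last first.
  have{s1} -> : s = 1%g.
    by apply/permP=> x; rewrite perm1; apply/eqP; rewrite -[_ == _]negbK s1.
  rewrite mul1g -addnA addnn -mul2n.
  have -> : #|porbits t| = n_comp (perms_link 1 t) predT.
    rewrite card_porbits_fcard; apply: n_comp_connect_same.
    - exact/fconnect_sym/perm_inj.
    - exact: perms_link_sym.
    - by move=> x _ /eqP<-; apply: perms_linkr.
    - move=> x y /orP[] /eqP->; first by rewrite perm1.
      by apply: connect1 => /=.
  by rewrite leq_add2r (leq_trans (leq_imset_card _ _)) // max_card.
(* [s'] is [s] with the point [x] made fixed. *)
pose x := s y; pose s' := (tperm x y * s)%g.
have xy : x != y by [].
have sE : s = (tperm x y * s')%g by rewrite /s' mulgA tperm2 mul1g.
have s's : #|porbits s'| = #|porbits s|.+1.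
  have := porbits_mul_tperm s x y; rewrite xy -/s' addn1 /=.
  have -> : x \in porbit s y by apply/porbitP; exists 1; rewrite expg1.
  by rewrite addn0.
have s'T : #|porbits s'| <= #|T| by rewrite (leq_trans (leq_imset_card _ _)) //
  max_card.
have {IHn} := IHn s'; rewrite s's => /(_ ltac:(lia)).
have := porbits_mul_tperm (s' * t)%g x y; rewrite /= mulgA -sE xy addn1.
set c' := n_comp _ _; set c := n_comp _ _.
have s'x : s' x = x by rewrite /s' permM tpermL.
have s'y : s' y = s x by rewrite /s' permM tpermR.
have s'z z : z != x -> z != y -> s' z = s z.
  by move=> zx zy; rewrite /s' permM tpermD // eq_sym.
have symL := perms_link_sym.
have c'c : c' <= c.+1.
  apply: (n_comp_add_edge (a := y) (b := x)) => // u v /orP[] /eqP->;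
    last first.
    by rewrite perms_linkr.
  have [->|uy] := eqVneq u y; first by rewrite -/x !connect0 orbT.
  have [->|ux] := eqVneq u x.
    by apply/or3P/Or33; rewrite -s'y connect0 perms_linkl.
  by rewrite -s'z // perms_linkl.
have same : x \in porbit (s' * t) y -> c' = c.
  move=> /connect_porbit_mul yx; apply: n_comp_connect_same =>
    // u v /orP[] /eqP->.
  - have e z : connect (perms_link s t) z (s z) := perms_linkl s t z.
    have [->|ux] := eqVneq u x; first by rewrite s'x.
    have [->|uy] := eqVneq u y; last by rewrite s'z.
    by rewrite s'y; apply: connect_trans (e y) (e x).
  - exact: perms_linkr.
  - have e z : connect (perms_link s' t) z (s' z) := perms_linkl s' t z.
    have [->|uy] := eqVneq u y; first exact: yx.
    have [->|ux] := eqVneq u x; last by rewrite -s'z.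
    by rewrite -s'y symL (connect_trans _ yx) // symL e.
  - exact: perms_linkr.
clearbody c c'; move: s's c'c; case: (x \in _) same => [/(_ isT)->|_] /=; clear.
all: move: #|porbits s'| #|porbits s| #|porbits (s * t)| #|porbits (s' * t)|
  #|porbits t| #|T|; lia.
Qed.

End Orbits.

(** * The Jordan curve theorem modulo two *)

Lemma ord4_ind (P : 'I_4 -> Prop) :
  P 0%R -> P 1%R -> P 2%R -> P 3%R -> forall i, P i.
Proof.
move=> P0 P1 P2 P3 [[|[|[|[|m]]]] lt4] //.
- by rewrite (_ : Ordinal _ = 0%R) //; apply: val_inj.
- by rewrite (_ : Ordinal _ = 1%R) //; apply: val_inj.
- by rewrite (_ : Ordinal _ = 2%R) //; apply: val_inj.
- by rewrite (_ : Ordinal _ = 3%R) //; apply: val_inj.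
Qed.

Lemma fcard_order (T : finType) (f : T -> T) n : injective f ->
  (forall x, fingraph.order f x = n) -> fcard f predT * n = #|T|.
Proof. by move=> injf ordf; apply: fcard_order_set => //; apply/subsetP=> x _;
  apply/eqP. Qed.

Lemma fcard_involution (T : finType) (f : T -> T) :
  involutive f -> (forall x, f x != x) -> fcard f predT * 2 = #|T|.
Proof.
move=> fK fN; apply: fcard_order => [|x]; first exact: inv_inj.
apply: (@order_cycle _ _ [:: x; f x]); rewrite /= ?inE ?eqxx //.
  by rewrite fK !eqxx.
by rewrite eq_sym fN.
Qed.

Lemma fcard_prod_bool (T : finType) (f : T -> T) : injective f ->
  fcard (fun u : T * bool => (f u.1, u.2)) predT = 2 * fcard f predT.
Proof.
move=> injf; pose f2 (u : T * bool) := (f u.1, u.2).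
rewrite -/f2.
have injf2 : injective f2 by case=> [x a] [y b] [/injf-> ->].
have step b : fcard f2 [pred u | u.2 == b] = fcard f predT.
  have cl : fclosed f2 [pred u | u.2 == b] by move=> u _ /eqP<-.
  rewrite (@adjunction_n_comp _ _ (fun x => (x, b)) _ (frel f) _ _ _ cl).
  - by apply: eq_n_comp_r => x; rewrite !inE eqxx.
  - exact: fconnect_sym.
  - exact: fconnect_sym.
  split=> [[x a] /eqP/= -> | x y _]; first by exists x.
  apply/idP/idP=> [|/iter_findex]; first case/connectP=> p; last first.
    move: (findex _ _ _) => i.
    suff -> : iter i f2 (x, b) = (iter i f x, b) by case=> <-;
      apply: fconnect_iter.
    by elim: i => //= i ->.
  move=> fp ->; elim: p x fp => //= z p IHp x /andP[/eqP<- /IHp];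
    apply: connect_trans.
  by apply: connect1; rewrite /f2 /=.
rewrite (n_compC [pred u | u.2 == true]) step -(step false) mul2n -addnn;
  congr (_ + _).
by apply: eq_n_comp_r => -[x b]; rewrite !inE; case: b.
Qed.

(** The set [L] is a cocycle modulo two: read [L x] as the jump of a colouring
    across the dart [x].  The jumps around a crossing cancel by [L_even], and
    [face] cancels the jump of [ccw] against that of [arc], so that only the
    vanishing of the first cohomology of the sphere is needed.  The proof
    looks at the double cover of the map defined by [L]: it has twice as many
    crossings, arcs and faces, hence twice the Euler characteristic, and
    [euler_inequality] forbids it to be connected. *)
Section Cocycle.
Variables (C : finType) (arc : dart C -> dart C).
Hypotheses (arcK : involutive arc) (arc_neq : forall x, arc x != x).
Hypotheses (planar : euler_planar arc) (conn : map_components arc <= 1).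
Variable L : pred (dart C).
Hypothesis L_arc : forall x, L (arc x) = L x.
Hypothesis L_even : forall c,
  L (c, 0%R) (+) L (c, 1%R) (+) L (c, 2%R) (+) L (c, 3%R) = false.

Let arc2 (u : dart C * bool) := (arc u.1, u.2 (+) L u.1).
Let ccw2 (u : dart C * bool) := (ccw u.1, u.2 (+) L u.1).

Let arc2K : involutive arc2.
Proof. by case=> x b; rewrite /arc2 /= arcK L_arc -addbA addbb addbF. Qed.

Lemma ccw4 (x : dart C) : ccw (ccw (ccw (ccw x))) = x.
Proof.
case: x => c i; rewrite /ccw /=; congr (_, _).
by move: i; apply: ord4_ind; apply: val_inj.
Qed.

Let ccw24 u : ccw2 (ccw2 (ccw2 (ccw2 u))) = u.
Proof.
case: u => x b; rewrite /ccw2 /= ccw4 -!addbA; congr (_, _).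
rewrite -[RHS]addbF; congr (_ (+) _).
case: x => c i; rewrite /ccw /=; move: i (L_even c).
have i4 : (3 + 1 = 0 :> 'I_4)%R by apply: val_inj.
by apply: ord4_ind; rewrite ?add0r -?(natrD _ 1 1) -?(natrD _ 2 1) ?i4 ?add0r;
  do 4! case: (L _).
Qed.

Let order_ccw2 u : fingraph.order ccw2 u = 4.
Proof.
apply: (@order_cycle _ _ [:: u; ccw2 u; ccw2 (ccw2 u); ccw2 (ccw2 (ccw2 u))]).
- by rewrite /= ccw24 !eqxx.
- apply: (@map_uniq _ _ (fun w => w.1.2)).
  by case: u => [[c i] b] /=; move: i; apply: ord4_ind.
- by rewrite inE eqxx.
Qed.
Lemma ccw_inj : injective (@ccw C).
Proof. by apply: (can_inj (g := fun x => ccw (ccw (ccw x)))) => x;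
  apply: ccw4. Qed.

Lemma map_link_sym : connect_sym (map_link arc).
Proof. by apply: two_maps_sym; [apply: inv_inj | apply: ccw_inj]. Qed.

Let arc2_inj : injective arc2. Proof. exact: inv_inj. Qed.

Let ccw2_inj : injective ccw2.
Proof. by apply: (can_inj (g := fun x => ccw2 (ccw2 (ccw2 x)))) => x;
  apply: ccw24. Qed.

Let link2 : rel (dart C * bool) := perms_link (perm arc2_inj) (perm ccw2_inj).

Let link2_sym : connect_sym link2 := @perms_link_sym _ _ _.

Let cover_disconnected : dart C -> 1 < n_comp link2 predT.
Proof.
move=> x0.
have := euler_inequality (perm arc2_inj) (perm ccw2_inj).
rewrite -/link2 !card_porbits_fcard.
rewrite (eq_fcard (permE arc2_inj)) (eq_fcard (permE ccw2_inj)).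
have -> : fcard (perm arc2_inj * perm ccw2_inj)%g predT = 2 * fcard (face arc)
  predT.
  rewrite -fcard_prod_bool; last by move=> x y /ccw_inj/(inv_inj arcK).
  apply: eq_fcard => -[x b]; rewrite permM !permE /ccw2 /arc2 /=.
  by rewrite L_arc -addbA addbb addbF.
have := fcard_order ccw2_inj order_ccw2.
have : fcard arc2 predT * 2 = #|{: dart C * bool}|.
  by apply: fcard_involution => // -[x b];
    rewrite xpair_eqE (negPf (arc_neq x)).
have := fcard_involution arcK arc_neq.
rewrite !card_prod card_ord card_bool.
have comp1 : map_components arc = 1.
  apply/eqP; rewrite eqn_leq conn /=; apply/card_gt0P.
  by exists (fingraph.root (map_link arc) x0);
    rewrite !inE (roots_root map_link_sym).
move: planar; rewrite /euler_planar comp1.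
move: #|C| (fcard (face arc) _) (fcard arc _) (fcard arc2 _) (fcard ccw2 _)
  (n_comp link2 _) => *; lia.
Qed.

Let link2_flip x b y a :
  connect link2 (x, b) (y, a) -> connect link2 (x, ~~ b) (y, ~~ a).
Proof.
pose fl (u : dart C * bool) := (u.1, ~~ u.2).
rewrite -[(x, ~~ b)]/(fl (x, b)) -[(y, ~~ a)]/(fl (y, a)).
move: (x, b) (y, a) => u v /connectP[p lp ->] {v}.
elim: p u lp => //= v p IHp u /andP[uv /IHp]; apply/connect_trans/connect1.
have flE (f : dart C -> dart C) w :
    (f (fl w).1, (fl w).2 (+) L (fl w).1) = fl (f w.1, w.2 (+) L w.1).
  by rewrite /fl /=; congr (_, _); case: (w.2); case: (L _).
by move: uv => /orP[] /eqP->; rewrite /link2 /perms_link /= !permE /arc2 /ccw2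
  !flE eqxx ?orbT.
Qed.

(** A sheet of the disconnected double cover is a section over all darts,
    that is, a colouring with the jumps [L]. *)
Lemma cocycle_coboundary :
  exists g : dart C -> bool,
    (forall x, g (arc x) = g x (+) L x) /\ (forall x, g (ccw x) = g x (+) L x).
Proof.
case: (pickP (mem {: dart C})) => [x0 _ | no]; last first.
  by exists xpred0; split=> x; have := no x.
pose e := connect link2 (x0, false).
have arce u v : e (u, v) -> e (arc u, v (+) L u).
  move/connect_trans; apply; apply: connect1.
  by rewrite /link2 /perms_link /= permE eqxx.
have ccwe u v : e (u, v) -> e (ccw u, v (+) L u).
  move/connect_trans; apply; apply: connect1.
  by rewrite /link2 /perms_link /= [X in _ || (_ == X)]permE eqxx orbT.
have lift y : exists b, e (y, b).
  have := elimT (n_comp_le1P map_link_sym) conn x0 y.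
  case/connectP=> p; elim/last_ind: p y => /= [|p z IHp] y.
    by move=> _ ->; exists false; apply: connect0.
  rewrite rcons_path last_rcons => /andP[/IHp/(_ erefl)[b eb] ez ->].
  by exists (b (+) L (last x0 p)); case/orP: ez => /eqP->;
    [apply: arce | apply: ccwe].
have not_both y b : e (y, b) -> ~~ e (y, ~~ b).
  move=> eb; apply/negP=> /link2_flip; rewrite negbK link2_sym => eb'.
  have et : e (x0, true) by apply: connect_trans eb eb'.
  have/negP[] : ~~ (n_comp link2 predT <= 1) by rewrite -ltnNge
    cover_disconnected.
  apply/(n_comp_le1P link2_sym) => u v.
  suff all w : e w by apply: connect_trans (all v); rewrite link2_sym;
    apply: all.
  case: w => z a; have [c ec] := lift z; have [->//|ac] := eqVneq a c.
  have -> : a = ~~ c by case: a c ac {ec} => [] [].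
  exact: connect_trans et (link2_flip ec).
have gE y b : e (y, b) -> e (y, true) = b.
  by case: b => // ef; apply: negbTE (not_both y false ef).
exists (fun y => e (y, true)); split=> x; have [b eb] := lift x.
  by rewrite (gE _ _ eb) (gE _ _ (arce _ _ eb)).
by rewrite (gE _ _ eb) (gE _ _ (ccwe _ _ eb)).
Qed.
End Cocycle.

Local Notation arc := Defs.arc.

(** * Loops of a state and change of one splicing *)

Section Splices.
Variable D : link_diagram.
Implicit Types (S : state D) (x y : dart (crossing D)) (c : crossing D).

Lemma A_spliceK : involutive A_splice.
Proof. by apply: ord4_ind; apply: val_inj. Qed.

Lemma B_spliceK : involutive B_splice.
Proof. by apply: ord4_ind; apply: val_inj. Qed.

Lemma B_spliceE i : B_splice i = (A_splice i + 1 + 1)%R.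
Proof. by move: i; apply: ord4_ind; apply: val_inj. Qed.

Lemma spliceK S : involutive (splice S).
Proof.
by case=> c i; rewrite /splice /=; case: ifP => cS;
  rewrite cS ?A_spliceK ?B_spliceK.
Qed.

Lemma state_link_sym S : connect_sym (state_link S).
Proof. by apply: two_maps_sym; apply: inv_inj;
  [apply: arcK | apply: spliceK]. Qed.

Lemma connect_arc S x : connect (state_link S) x (arc x).
Proof. by apply: connect1; rewrite /state_link /= eqxx. Qed.

Lemma connect_splice S x : connect (state_link S) x (splice S x).
Proof. by apply: connect1; rewrite /state_link /= eqxx orbT. Qed.

Lemma card_dart_loops S : #|dart_loops S| = n_comp (state_link S) predT.
Proof.
rewrite (n_comp_card_classes (@state_link_sym S)) /dart_loops.
apply: eq_card => L; by apply/imsetP/imsetP=> -[x _ ->]; exists x; rewrite ?inE.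
Qed.

Lemma card_loop S : #|loop S| = n_comp (state_link S) predT + circles D.
Proof.
rewrite /loop card_sum card_ord -card_dart_loops card_sig; congr (_ + _).
Qed.

Lemma eq_loop_of S x y : (loop_of S x == loop_of S y) = connect (state_link S)
  x y.
Proof.
have symS := @state_link_sym S.
apply/eqP/idP=> [[/setP/(_ y)] | xy]; first by rewrite !inE connect0.
congr inl; apply: val_inj => /=; apply/setP=> z; rewrite !inE.
exact: same_connect.
Qed.

(** The spliced spot at [c] has the same loop of [S] on both sides.  The ends
    [0] and [2] lie on different sides for both splicings. *)
Definition touches S c : bool := connect (state_link S) (c, 0%R) (c, 2%R).

(** A checkerboard colouring [k] of the regions, carried over to darts,
    orients every arc from one colour to the other.  At a crossing the
    orientations alternate, so that all loops of all states are coherently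
    oriented, and the darts of colour [true] meet each arc once. *)
Section Checkerboard.
Variable k : dart (crossing D) -> bool.
Hypothesis k_arc : forall x, k (arc x) = ~~ k x.
Hypothesis k_ccw : forall x, k (ccw x) = ~~ k x.

Lemma color_ends c :
  (k (c, 1%R) = ~~ k (c, 0%R)) * (k (c, 2%R) = k (c, 0%R))
  * (k (c, 3%R) = ~~ k (c, 0%R)).
Proof.
have e1 : k (c, 1%R) = ~~ k (c, 0%R) by rewrite -k_ccw /ccw /= add0r.
have e2 : k (c, 2%R) = k (c, 0%R) by rewrite -[RHS]negbK -e1 -k_ccw /ccw /=
  -(natrD _ 1 1).
by split; last rewrite -e2 -k_ccw /ccw /= -(natrD _ 2 1).
Qed.

Lemma color_end c i : k (c, i) = k (c, 0%R) (+) odd i.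
Proof. by move: i; apply: ord4_ind; rewrite ?color_ends ?addbT ?addbF. Qed.

Lemma opposite_end c i j : k (c, i) -> k (c, j) -> j = i \/ j = (i + 1 + 1)%R.
Proof.
rewrite (color_end c i) (color_end c j) => ki kj.
have {ki kj} : odd i = odd j by move: ki kj; case: (k _); case: (odd i);
  case: (odd j).
move: i j; do 2![apply: ord4_ind] => // _; try (by left); by right;
  apply: val_inj.
Qed.

Lemma k_splice S x : k (splice S x) = ~~ k x.
Proof.
case: x => c i; rewrite /splice /=; case: ifP => _; move: i; apply: ord4_ind.
- by rewrite [A_splice _](_ : _ = 1)%R ?color_ends //; apply: val_inj.
- by rewrite [A_splice _](_ : _ = 0)%R ?color_ends ?negbK //; apply: val_inj.
- by rewrite [A_splice _](_ : _ = 3)%R ?color_ends //; apply: val_inj.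
- by rewrite [A_splice _](_ : _ = 2)%R ?color_ends ?negbK //; apply: val_inj.
- by rewrite [B_splice _](_ : _ = 3)%R ?color_ends //; apply: val_inj.
- by rewrite [B_splice _](_ : _ = 2)%R ?color_ends ?negbK //; apply: val_inj.
- by rewrite [B_splice _](_ : _ = 1)%R ?color_ends //; apply: val_inj.
- by rewrite [B_splice _](_ : _ = 0)%R ?color_ends ?negbK //; apply: val_inj.
Qed.

Definition strand : finType := {x : dart (crossing D) | k x}.

Lemma next_subproof S (x : strand) : k (splice S (arc (val x))).
Proof. by rewrite k_splice k_arc negbK (valP x). Qed.

Definition next S (x : strand) : strand := exist k _ (next_subproof S x).

Lemma next_inj S : injective (next S).
Proof.
by move=> x y /(congr1 val)/(inv_inj (spliceK S))/(inv_inj (@arcK D))/val_inj.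
Qed.

Definition loop_perm S : {perm strand} := perm (@next_inj S).

(** Following a loop in one direction already reaches all of it. *)
Lemma connect_next S (x y : strand) :
  connect (state_link S) (val x) (val y) = fconnect (next S) x y.
Proof.
apply/idP/idP => [|/connectP[p]]; last first.
  elim: p x => [|z p IHp] x /=; first by move=> _ ->; apply: connect0.
  case/andP=> /eqP<- /IHp{}IHp /IHp; apply: connect_trans.
  exact: connect_trans (connect_arc _ _) (connect_splice _ _).
(* Each dart is represented by the dart of colour [true] on its arc. *)
pose fwd z := if insub z is Some s then fconnect (next S) x s
              else if insub (arc z) is Some s then fconnect (next S) x s else
                false.
suff fwd_inv u v : state_link S u v -> fwd u = fwd v.
  move=> /(connect_invariant fwd_inv); rewrite /fwd !valK => <-.
  exact: connect0.
have fwd_arc z : fwd (arc z) = fwd z.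
  rewrite /fwd arcK; have [kz|kz] := boolP (k z).
    by rewrite [insub (arc z)]insubF ?k_arc ?kz //=; case: insubP => //;
      rewrite kz.
  by rewrite [insub z]insubF ?(negPf kz) //; case: insubP => //;
    rewrite k_arc kz.
have fwd_splice z : k z -> fwd (splice S z) = fwd z.
  move=> kz; rewrite /fwd (insubT (fun z => k z) kz) insubF ?k_splice ?kz //.
  have kz' : k (arc (splice S z)) by rewrite k_arc k_splice kz.
  rewrite (insubT (fun z => k z) kz') /=.
  apply: same_connect_r (fconnect_sym (@next_inj S)) _ _ _ _.
  apply: connect1; apply/eqP/val_inj => /=; rewrite arcK; exact: spliceK.
case/orP=> /eqP->; first by rewrite fwd_arc.
have [kz|kz] := boolP (k u); first by rewrite fwd_splice.
by rewrite -[in LHS](spliceK S u) fwd_splice // k_splice kz.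
Qed.

Lemma card_porbits_loop_perm S : #|porbits (loop_perm S)| = n_comp (state_link
  S) predT.
Proof.
rewrite card_porbits_fcard (eq_fcard (permE (@next_inj S))); apply/esym.
apply: (@adjunction_n_comp _ _ val).
- exact: state_link_sym.
- exact/fconnect_sym/next_inj.
- by [].
split=> [z _ | x y _]; last by rewrite connect_next.
have [kz|kz] := boolP (k z); first by exists (exist k z kz); apply: connect0.
have kz' : k (arc z) by rewrite k_arc kz.
by exists (exist k _ kz'); apply: connect_arc.
Qed.

(** The two splicings differ by exchanging opposite ends, so on darts of one
    colour the permutation following the loops gets multiplied by a single
    transposition.  This is where orientability is needed: without it a
    change of splicing could leave the number of loops unchanged. *)
Lemma loops_toggle S c : c \in S ->
  #|loop (S :\ c)| + (~~ touches S c).*2 = #|loop S|.+1.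
Proof.
rewrite /touches => cS; rewrite !card_loop -!card_porbits_loop_perm.
have [i [ki]] : exists i, k (c, i) /\
    connect (state_link S) (c, i) (c, i + 1 + 1)%R
      = connect (state_link S) (c, 0%R) (c, 2%R).
  have [kc0|kc1] := boolP (k (c, 0%R)).
    exists 0%R; split=> //; congr (connect _ _ (_, _)); exact: val_inj.
  exists 1%R; rewrite color_ends kc1; split=> //.
  have e j : connect (state_link S) (c, j) (c, A_splice j).
    by have := connect_splice S (c, j); rewrite /splice /= cS.
  rewrite (same_connect (@state_link_sym S) (e 0%R)).
  rewrite (same_connect_r (@state_link_sym S) (e 2%R)).
  by congr (connect _ (_, _) (_, _)); apply: val_inj.
have ki2 : k (c, (i + 1 + 1)%R) by rewrite -!/(ccw (c, _)) !k_ccw negbK.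
pose p : strand := exist k _ ki; pose q : strand := exist k _ ki2.
have -> : loop_perm (S :\ c) = (loop_perm S * tperm p q)%g.
  apply/permP => x; rewrite permM ![loop_perm _ _]permE.
  have [nc|nc] := eqVneq (val (next S x)).1 c; last first.
    rewrite tpermD; last 2 first.
    - by apply: contra_neq nc => <-.
    - by apply: contra_neq nc => <-.
    apply: val_inj; rewrite /= /splice !inE.
    by rewrite (_ : _ == c = false) //; apply/negbTE.
  have kn : k (c, (val (next S x)).2) by rewrite -nc -surjective_pairing (valP
    (next S x)).
  have nxt : (arc (val x)).1 = c by rewrite -nc.
  have [ni|ni] := opposite_end ki kn.
    have -> : next S x = p.
      by apply: val_inj; rewrite [LHS]surjective_pairing nc ni.
    rewrite tpermL; apply: val_inj => /=;
      rewrite /splice nxt !inE eqxx /= B_spliceE.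
    by rewrite -ni /= nxt cS.
  have -> : next S x = q.
    by apply: val_inj; rewrite [LHS]surjective_pairing nc ni.
  rewrite tpermR; apply: val_inj => /=;
    rewrite /splice nxt !inE eqxx /= B_spliceE.
  move: ni; rewrite /= nxt cS => ->; congr (_, _).
  by move: (i); apply: ord4_ind; apply: val_inj.
move=> same; have pq : p != q.
  rewrite -val_eqE /= xpair_eqE eqxx /=.
  by move: (i); apply: ord4_ind.
have swap : ((loop_perm S * tperm p q)^-1 = tperm p q * (loop_perm S)^-1)%g.
  by rewrite invMg tpermV.
have := porbits_mul_tperm (loop_perm S)^-1%g p q; rewrite /= -swap.
rewrite !porbitsV porbitV porbit_sym mem_porbitE pq.
rewrite (eq_fconnect (permE (@next_inj S))) -connect_next /= same.
case: (connect _ _ _); rewrite /=; set a := #|_|; set b := #|_|; lia.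
Qed.

End Checkerboard.
End Splices.

(** * Separation by a loop *)

Section Separation.
Variable D : link_diagram.
Hypothesis conn : diagram_connected D.
Implicit Types (S : state D) (x y : dart (crossing D)) (c e f : crossing D).

Lemma jordan_coloring (L : pred (dart (crossing D))) :
    (forall x, L (arc x) = L x) ->
    (forall c,
       L (c, 0%R) (+) L (c, 1%R) (+) L (c, 2%R) (+) L (c, 3%R) = false) ->
  exists g : dart (crossing D) -> bool,
    (forall x, g (arc x) = g x (+) L x) /\ (forall x, g (ccw x) = g x (+) L x).
Proof.
apply: cocycle_coboundary (@arcK D) (@arc_neq D) (@arc_planar D) _ L.
by rewrite -conn leq_addr.
Qed.

(** Every arc is a wall. *)
Lemma checkerboard : exists k : dart (crossing D) -> bool,
  (forall x, k (arc x) = ~~ k x) /\ (forall x, k (ccw x) = ~~ k x).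
Proof.
have [//|//|k [karc kccw]] := @jordan_coloring predT.
by exists k; split=> x; rewrite ?karc ?kccw addbT.
Qed.

Section Checkerboard.
Variable k : dart (crossing D) -> bool.
Hypothesis k_arc : forall x, k (arc x) = ~~ k x.
Hypothesis k_ccw : forall x, k (ccw x) = ~~ k x.

(** Given the splicing, the trace at [c] lies in a region of one of the two
    colours, which this tells apart. *)
Definition side S c : bool := k (c, 0%R) (+) (c \notin S).

Lemma splice_ends S c : if c \in S
  then ((splice S (c, 0%R) = (c, 1%R)) * (splice S (c, 2%R) = (c, 3%R)))%type
  else ((splice S (c, 0%R) = (c, 3%R)) * (splice S (c, 2%R) = (c, 1%R)))%type.
Proof.
by case: ifP => cS; rewrite /splice /= cS; split; congr (_, _); apply: val_inj.
Qed.

(** Each of the two pieces at a spliced crossing has exactly one of the ends 0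
    and 2. *)
Lemma splice_invariantP (A : Type) (phi : dart (crossing D) -> A) S c :
    phi (splice S (c, 0%R)) = phi (c, 0%R) ->
    phi (splice S (c, 2%R)) = phi (c, 2%R) ->
  forall i, phi (splice S (c, i)) = phi (c, i).
Proof.
move=> h0 h2; have sK := spliceK S; apply: ord4_ind => //;
  have := splice_ends S c.
  by case: ifP => _ [e0 e2]; rewrite -?e0 -?e2 sK ?h0 ?h2.
by case: ifP => _ [e0 e2]; rewrite -?e0 -?e2 sK ?h0 ?h2.
Qed.

(** The loop [M] of [S] through the end [0] of [f] is a Jordan curve.  Colour
    the other loops by the side of [M] they are on, and [M] itself like the
    loops seen from it across traces of colour [s].  Then a trace of colour
    [s] always joins loops of equal colour, whereas a trace of the other
    colour that leaves [M] leads to the opposite side. *)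
Lemma separating_coloring S f (s : bool) : ~~ touches S f ->
  exists h : dart (crossing D) -> bool,
    [/\ forall x, h (arc x) = h x, forall x, h (splice S x) = h x,
        forall c, side S c = s -> h (c, 0%R) = h (c, 2%R)
      & side S f != s -> h (f, 0%R) != h (f, 2%R)].
Proof.
rewrite /touches => f02; pose M x := connect (state_link S) (f, 0%R) x.
have symS := @state_link_sym D S.
have Marc x : M (arc x) = M x by rewrite /M (same_connect_r symS (connect_arc S
  x)).
have Msplice x : M (splice S x) = M x.
  by rewrite /M (same_connect_r symS (connect_splice S x)).
have [//|c|g [garc gccw]] := @jordan_coloring M.
  have := Msplice (c, 0%R); have := Msplice (c, 2%R); have := splice_ends S c.
  by case: ifP => _ [-> ->] -> ->; do 2! case: (M _).
have g1 c : g (c, 1%R) = g (c, 0%R) (+) M (c, 0%R) by rewrite -gccw /ccw add0r.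
have g2 c : g (c, 2%R) = g (c, 0%R) (+) M (c, 0%R) (+) M (c, 1%R).
  by rewrite -g1 -gccw /ccw -(natrD _ 1 1).
have g3 c : g (c, 3%R) = g (c, 0%R) (+) M (c, 0%R) (+) M (c, 1%R) (+) M (c,
  2%R).
  by rewrite -g2 -gccw /ccw -(natrD _ 2 1).
have kends c := color_ends k_ccw c.
(* On [M] both [g] and [k] flip at each step, so [g (+) k] is constant. *)
pose h x := g x (+) (M x && (k x (+) s)).
have hE c : (h (splice S (c, 0%R)) = h (c, 0%R))
    * (h (splice S (c, 2%R)) = h (c, 2%R))
    * (h (c, 0%R) (+) h (c, 2%R) =
         (M (c, 0%R) (+) M (c, 2%R)) && (side S c (+) s)).
  have := Msplice (c, 0%R); have := Msplice (c, 2%R); have := splice_ends S c.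
  rewrite /h /side; case: ifP => cS [-> ->] E2 E0;
    rewrite ?g1 ?g2 ?g3 ?kends ?E0 ?E2 ?cS /=;
    by case: (g _); case: (M _); case: (M _); case: (k _); case: (s).
exists h; split=> [x|[c i]|c sc|sf].
- by rewrite /h garc Marc k_arc; case: (M x); case: (g x); case: (k x);
  case: (s).
- by apply: splice_invariantP; rewrite hE.
- apply/eqP; rewrite -[_ == _]negbK negb_eqb hE sc addbb andbF //.
- rewrite negb_eqb hE /M connect0 (negPf f02) /= -negb_eqb //.
Qed.
End Checkerboard.
End Separation.

(** * Counting the loops of all states *)

Lemma superset_ind (C : finType) (A : {set C}) (P : {set C} -> Prop) :
    P A ->
    (forall c (T : {set C}), A \subset T -> c \notin T -> P T -> P (c |: T)) ->
  forall T : {set C}, A \subset T -> P T.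
Proof.
move=> PA Padd T; have [n] := ubnP #|T :\: A|; elim: n T => // n IHn T leTn sAT.
have [TA | [c]] := set_0Vmem (T :\: A).
  suff -> : T = A by [].
  by apply/eqP; rewrite eqEsubset sAT andbT -setD_eq0 TA.
rewrite inE => /andP[cA cT]; rewrite -(setD1K cT).
have sAT' : A \subset T :\ c by rewrite subsetD1 sAT.
apply: Padd; rewrite ?setD11 //; apply: IHn => //.
move: leTn; rewrite (cardsD1 c (T :\: A)) !inE cA cT /=.
by rewrite setDDl setUC -setDDl.
Qed.

Section Parallel.
Variable D : link_diagram.
Hypothesis conn : diagram_connected D.
Hypothesis adeq : A_adequate D.
Implicit Types (S T : state D) (x y : dart (crossing D)) (c e f : crossing D).

Local Notation par := (@parallel (A_graph D)).
Local Notation A_loop := (loop_of (A_state D)).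

Lemma parallel_refl (G : multigraph) : reflexive (@parallel G).
Proof. by move=> e; rewrite /parallel /= !eqxx. Qed.

Lemma parallel_sym (G : multigraph) : symmetric (@parallel G).
Proof.
move=> e f; rewrite /parallel /= [src f == src e]eq_sym [tgt f == tgt e]eq_sym.
by rewrite [src f == tgt e]eq_sym [tgt f == src e]eq_sym [(tgt e == _) &&
  _]andbC.
Qed.

Lemma parallel_trans (G : multigraph) : transitive (@parallel G).
Proof.
move=> f e g; rewrite /parallel /=.
by case/orP=> /andP[/eqP-> /eqP->] /orP[] /andP[/eqP-> /eqP->];
  rewrite !eqxx ?orbT.
Qed.

Lemma A_untouched c : ~~ touches (A_state D) c.
Proof. by have := adeq c; rewrite eq_loop_of. Qed.

Lemma loop_invariantP (A : eqType) (h : dart (crossing D) -> A) S :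
    (forall x, h (arc x) = h x) -> (forall x, h (splice S x) = h x) ->
  forall x y, loop_of S x = loop_of S y -> h x = h y.
Proof.
move=> harc hsplice x y /eqP; rewrite eq_loop_of.
by apply: connect_invariant => u v /orP[] /eqP->.
Qed.

Lemma eq_splice S S' x : (x.1 \in S) = (x.1 \in S') -> splice S x = splice S' x.
Proof. by rewrite /splice => ->. Qed.

Lemma parallel_ends (A : eqType) (h : dart (crossing D) -> A) e f :
    (forall x y, A_loop x = A_loop y -> h x = h y) -> par e f ->
  (h (e, 0%R) == h (e, 2%R)) = (h (f, 0%R) == h (f, 2%R)).
Proof.
by move=> hA /orP[] /andP[/eqP/hA-> /eqP/hA->].
Qed.

Section Checkerboard.
Variable k : dart (crossing D) -> bool.
Hypothesis k_arc : forall x, k (arc x) = ~~ k x.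
Hypothesis k_ccw : forall x, k (ccw x) = ~~ k x.

(** Traces in regions of different colours leave a loop on different sides, so
    they cannot lead to the same other loop. *)
Lemma parallel_same_color e f : par e f -> k (e, 0%R) = k (f, 0%R).
Proof.
move=> ef.
have [h [harc hsplice hs hf]] :=
  separating_coloring conn k_arc k_ccw (k (e, 0%R)) (A_untouched f).
have sideA c : side k (A_state D) c = k (c, 0%R) by rewrite /side inE addbF.
have hA := loop_invariantP harc hsplice.
apply/eqP; rewrite eq_sym; apply: contraT; rewrite -sideA => /hf.
by rewrite -(parallel_ends hA ef) hs ?eqxx.
Qed.

(** Splicing the crossings of [T] the other way moves their traces into regions
    of the opposite colour, and the trace of [f] keeps its own.  Through the
    crossings of [T] the loops at the ends of [f] communicate, since [e] joins
    the same two loops of the A-state; [separating_coloring] then forbids the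
    trace of [f] to join two distinct loops. *)
Lemma parallel_touches T e f :
    e \in T -> f \notin T -> {in T, forall c, par c f} ->
  touches (~: T) f.
Proof.
move=> eT fT parT; apply: contraT =>
  /(separating_coloring conn k_arc k_ccw (~~ k (f, 0%R))).
case=> h [harc hsplice hs].
have -> : side k (~: T) f = k (f, 0%R) by rewrite /side !inE negbK (negPf fT)
  addbF.
have hT c : c \in T -> h (c, 0%R) = h (c, 2%R).
  move=> cT; apply: hs; rewrite /side !inE negbK cT addbT.
  by rewrite (parallel_same_color (parT c cT)).
have hA x : h (splice (A_state D) x) = h x.
  have [xT|xT] := boolP (x.1 \in T); last first.
    by rewrite (@eq_splice _ (~: T)) // !inE.
  case: x xT => c i /= cT; apply: splice_invariantP.
    have := splice_ends (A_state D) c; rewrite inE => -[-> _].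
    have := hsplice (c, 2%R); have := splice_ends (~: T) c.
    by rewrite !inE cT => -[_ ->] ->; rewrite hT.
  have := splice_ends (A_state D) c; rewrite inE => -[_ ->].
  have := hsplice (c, 0%R); have := splice_ends (~: T) c.
  by rewrite !inE cT => -[-> _] ->; rewrite hT.
have {}hA := loop_invariantP harc hA.
case: (k _) => /(_ isT); by rewrite -(parallel_ends hA (parT e eT)) hT ?eqxx.
Qed.
End Checkerboard.

(** The loops of the state that differs from the A-state at [e] only, named
    after the loops of the A-state. *)
Definition merged e x :=
  if A_loop x == A_loop (e, 2%R) then A_loop (e, 0%R) else A_loop x.

Lemma merge_nonparallel e f : ~~ par e f -> ~~ touches (~: [set e]) f.
Proof.
apply: contra => ef.
have marc x : merged e (arc x) = merged e x.
  by rewrite /merged (_ : A_loop (arc x) = A_loop x) //; apply/eqP;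
    rewrite eq_loop_of state_link_sym connect_arc.
have Aspl x : A_loop (splice (A_state D) x) = A_loop x.
  by apply/eqP; rewrite eq_loop_of state_link_sym connect_splice.
have mA x : merged e (splice (A_state D) x) = merged e x by rewrite /merged
  Aspl.
have mspl x : merged e (splice (~: [set e]) x) = merged e x.
  have [xe|xe] := eqVneq x.1 e; last first.
    by rewrite (@eq_splice _ (A_state D)) // !inE xe.
  case: x xe => c i /= ->.
  have e02 : merged e (e, 0%R) = merged e (e, 2%R).
    by rewrite /merged eqxx; case: eqP.
  have := splice_ends (A_state D) e; rewrite inE => -[a0 a2].
  apply: splice_invariantP; have := splice_ends (~: [set e]) e;
    rewrite !inE eqxx => -[s0 s2].
    by rewrite s0 -a2 mA.
  by rewrite s2 -a0 mA.
have /(loop_invariantP marc mspl) :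
    loop_of (~: [set e]) (f, 0%R) = loop_of (~: [set e]) (f, 2%R).
  by apply/eqP; rewrite eq_loop_of.
have /eqP nf := adeq f; rewrite /merged /parallel /=.
case: eqP => [E0|_]; case: eqP => [E2|_] E.
- by case: nf; rewrite /= E0 E2.
- by rewrite E0 E !eqxx orbT.
- by rewrite E E2 !eqxx.
- by case: nf.
Qed.

(** When the crossings of [T] are changed one at a time from A- to B-splicings,
    this is the number of changes that merge two loops. *)
Definition merges T : nat := (#|loop (A_state D)| + #|T| - #|loop (~: T)|)./2.

Lemma add_crossing T c : c \notin T ->
  #|loop (~: (c |: T))| + (~~ touches (~: T) c).*2 = #|loop (~: T)|.+1.
Proof.
move=> cT; have [k [k_arc k_ccw]] := checkerboard conn.
have -> : ~: (c |: T) = ~: T :\ c by rewrite setCU setIC setDE.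
by rewrite (loops_toggle k_arc k_ccw) // inE.
Qed.

Lemma setC0_state : ~: set0 = A_state D. Proof. exact: setC0. Qed.

Lemma mergesE T : #|loop (~: T)| + (merges T).*2 = #|loop (A_state D)| + #|T|.
Proof.
suff [m Em] : exists m, #|loop (~: T)| + m.*2 = #|loop (A_state D)| + #|T|.
  by rewrite /merges -Em addKn doubleK.
move: T (sub0set T); apply: superset_ind => [|c T _ cT [m Em]].
  by exists 0; rewrite cards0 setC0_state.
exists (m + ~~ touches (~: T) c).
have := add_crossing cT; rewrite cardsU1 cT.
move: #|loop (~: (c |: T))| #|loop (~: T)| (nat_of_bool (~~ _)) Em => a b d;
  lia.
Qed.

Lemma merges_add T c : c \notin T -> merges (c |: T) = merges T + ~~ touches
  (~: T) c.
Proof.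
move=> cT; have := mergesE T; have := mergesE (c |: T); have := add_crossing cT.
rewrite cardsU1 cT.
by move: #|loop (~: (c |: T))| #|loop (~: T)| (nat_of_bool (~~ _)) => a b d;
  lia.
Qed.

Lemma merges_sub T T' : T \subset T' -> merges T <= merges T'.
Proof.
move: T'; apply: superset_ind => [|c T' _ cT le_m]; first exact: leqnn.
by rewrite (merges_add cT); apply: leq_trans le_m (leq_addr _ _).
Qed.

Lemma merges0 : merges set0 = 0.
Proof. by have := mergesE set0; rewrite setC0_state cards0; lia. Qed.

Lemma merges1 e : merges [set e] = 1.
Proof. by rewrite -[[set e]]setU0 merges_add ?inE // merges0 setC0_state
  A_untouched. Qed.

(** The first change merges the two loops, and by [parallel_touches] each
    further one splits a loop. *)
Lemma merges_clique T e : e \in T -> {in T, forall c, par c e} -> merges T = 1.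
Proof.
rewrite -sub1set => eT; move: T eT.
apply: superset_ind => [_|c T]; first exact: merges1.
rewrite sub1set => eT cT IHT parT; rewrite (merges_add cT).
rewrite IHT => [|f fT]; last by apply: parT; rewrite !inE fT orbT.
have [k [k_arc k_ccw]] := checkerboard conn.
suff -> : touches (~: T) c by [].
apply: (parallel_touches k_arc k_ccw eT cT) => f fT.
have fe : par f e by apply: parT; rewrite !inE fT orbT.
apply: parallel_trans fe _; rewrite parallel_sym; apply: parT.
by rewrite !inE eqxx.
Qed.

Lemma merges_nonclique T e f : e \in T -> f \in T -> ~~ par e f -> 1 < merges T.
Proof.
move=> eT fT nef.
have fe : f \notin [set e] by rewrite inE; apply: contraNneq nef => ->;
  apply: parallel_refl.
have <- : merges (f |: [set e]) = 2 by rewrite merges_add // merges1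
  merge_nonparallel.
by apply: merges_sub; rewrite subUset !sub1set eT fT.
Qed.

Lemma merges_gt0 T e : e \in T -> 0 < merges T.
Proof. by move=> eT; rewrite -(merges1 e) merges_sub // sub1set. Qed.

Lemma card_loop_gt0 S : 0 < #|loop S|.
Proof.
case: (pickP (mem {: dart (crossing D)})) => [x _ | no].
  by apply/card_gt0P; exists (loop_of S x).
have := conn; rewrite /diagram_connected /map_components.
rewrite (_ : n_comp _ _ = 0); first by rewrite add0n card_loop => ->;
  rewrite addn1.
by apply: eq_card0 => x; have := no x.
Qed.
End Parallel.

Local Open Scope ring_scope.

(** * Sums over sets of parallel edges *)

(** Expand the product over all [j] of [F j + 1], which has a factor 0. *)
Lemma sum_signs_subsets (I : finType) (A : {set I}) (R : comNzRingType) i :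
    i \in A ->
  \sum_(T : {set I} | T \subset A) (-1) ^+ #|T| = 0 :> R.
Proof.
move=> iA; pose F j : R := if j \in A then -1 else 0.
transitivity (\prod_j (F j + 1)); last first.
  by rewrite (bigD1 i) //= /F iA addNr mul0r.
rewrite bigA_distr [LHS]big_mkcond /=; apply: eq_bigr => T _.
rewrite -big_mkcond /=; case: ifP => [/subsetP TA | /subsetPn[j jT jA]].
  by rewrite (eq_bigr (fun=> -1)) ?prodr_const // => j /TA; rewrite /F => ->.
by rewrite (bigD1 j) //= /F (negPf jA) mul0r.
Qed.

Section Cliques.
Variable G : multigraph.
Local Notation par := (@parallel G).

Definition clique (T : {set edge G}) := [forall e in T, forall f in T, par e f].

Lemma kept_representative (e : edge G) : exists2 r, kept_edge r & par e r.
Proof.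
have := parallel_refl e.
case: (arg_minnP (P := par e) (fun f => enum_rank f) (parallel_refl e)) =>
  r er min_r _.
exists r => //; apply/forallP=> f; apply/implyP=> rf.
by apply: min_r; apply: parallel_trans er rf.
Qed.

Lemma kept_unique (r s : edge G) : kept_edge r -> kept_edge s -> par r s -> r =
  s.
Proof.
move=> /forallP/(_ s)/implyP kr /forallP/(_ r)/implyP ks rs.
apply: enum_rank_inj; apply: val_inj; apply/eqP; rewrite eqn_leq.
by rewrite kr // ks // parallel_sym.
Qed.

(** Each class of parallel edges contributes the sum of signs of its nonempty
    subsets, which is -1. *)
Lemma sum_signs_cliques :
  \sum_(T : {set edge G} | (T != set0) && clique T) (-1) ^+ #|T|
    = - (#|edge (reduction G)|%:R : int).
Proof.
pose cls r := [set e | par r e].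
transitivity (\sum_(r : edge G | kept_edge r)
    \sum_(T : {set edge G} | (T != set0) && (T \subset cls r))
      (-1 : int) ^+ #|T|).
  rewrite (exchange_big_dep (fun T : {set edge G} =>
    (T != set0) && clique T)) /=.
    apply: eq_bigr => T /andP[/set0Pn[e eT] cl].
    have [r kr er] := kept_representative e.
    rewrite (big_pred1 r) // => s; rewrite /= -/(cls s).
    have -> : T != set0 by apply/set0Pn; exists e.
    apply/andP/eqP => [[ks /subsetP/(_ e eT)] | ->].
      by rewrite inE => se; apply: kept_unique => //;
        apply: parallel_trans se er.
    split=> //; apply/subsetP=> f fT; rewrite inE.
    move/forallP/(_ e)/implyP/(_ eT)/forallP/(_ f)/implyP/(_ fT) : cl.
    by apply: parallel_trans; rewrite parallel_sym.
  move=> r T kr /andP[-> /subsetP Tr]; apply/forallP=> e; apply/implyP=> /Tr re.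
  apply/forallP=> f; apply/implyP=> /Tr; move: re; rewrite !inE parallel_sym.
  exact: parallel_trans.
rewrite (eq_bigr (fun=> -1)) => [|r kr].
  by rewrite sumr_const mulNrn card_sig.
have rr : r \in cls r by rewrite inE parallel_refl.
have := sum_signs_subsets int rr;
  rewrite (bigD1 set0) ?sub0set //= cards0 expr0.
move/eqP; rewrite addrC addr_eq0 => /eqP E; rewrite -[RHS]E.
by apply: eq_bigl => T; rewrite andbC.
Qed.
End Cliques.

(** * The first two coefficients of the state sum *)

Lemma coef_binomial n :
  (((1 + 'X) ^+ n : {poly int})`_0 = 1)
  /\ (((1 + 'X) ^+ n : {poly int})`_1 = n%:Z).
Proof.
elim: n => [|n [IH0 IH1]]; first by rewrite expr0 !coef1.
rewrite exprS mulrDl mul1r !coefD !coefXM /= IH0 IH1 addr0; split=> //.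
by rewrite intS addrC.
Qed.

Section BracketPolynomial.
Variable D : link_diagram.
Hypothesis conn : diagram_connected D.
Hypothesis adeq : A_adequate D.
Implicit Types (T : state D).

(** Up to a unit common to all states, the contribution to the bracket of the
    state whose B-spliced crossings are [T], in the variable [t]. *)
Definition bracket_term T : {poly int} :=
  (-1) ^+ (#|loop (~: T)|.-1)
  * ('X^(merges T) * (1 + 'X) ^+ (#|loop (~: T)|.-1)).

Definition bracket_poly : {poly int} := \sum_T bracket_term T.

Local Notation v := (#|loop (A_state D)|).

(** The number of loops and [v + #|T|] differ by twice [merges T]. *)
Lemma sign_loops T :
  (-1) ^+ (#|loop (~: T)|.-1) = (-1) ^+ v.-1 * (-1) ^+ #|T| :> int.
Proof.
rewrite -exprD -signr_odd -[RHS]signr_odd; congr (_ ^+ (nat_of_bool _)).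
have := mergesE conn T; have := card_loop_gt0 conn (~: T);
  have := card_loop_gt0 conn (A_state D).
move: #|loop _| #|loop _| (merges T) #|T|; lia.
Qed.

Lemma coef_bracket_term T i : (bracket_term T)`_i =
  (-1) ^+ v.-1 * (-1) ^+ #|T|
  * (if (i < merges T)%N then 0
     else ((1 + 'X) ^+ (#|loop (~: T)|.-1) : {poly int})`_(i - merges T)).
Proof.
rewrite /bracket_term -[in LHS](rmorph_sign polyC) coefCM sign_loops coefXnM.
by [].
Qed.

Lemma bracket_poly_coef0 : bracket_poly`_0 = (-1) ^+ v.-1.
Proof.
rewrite /bracket_poly coef_sum (bigD1 set0) //= big1 => [|T]; last first.
  by case/set0Pn=> e eT; rewrite coef_bracket_term (merges_gt0 conn adeq eT)
    mulr0.
rewrite addr0 coef_bracket_term merges0 // cards0 expr0 /= mulr1.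
by rewrite (coef_binomial _).1 mulr1.
Qed.

(** The A-state contributes the linear term of [(1 + 'X) ^+ (v - 1)]; the other
    states with a linear term are those with [merges T = 1]. *)
Lemma bracket_poly_coef1 : bracket_poly`_1 =
  (-1) ^+ v.-1 * (v%:Z - 1 - #|edge (reduction (A_graph D))|%:Z).
Proof.
rewrite /bracket_poly coef_sum (bigD1 set0) //= coef_bracket_term merges0 //
  cards0.
rewrite expr0 mulr1 subn0 (coef_binomial _).2 setC0_state.
have -> : (v.-1)%:Z = v%:Z - 1 by have := card_loop_gt0 conn (A_state D); lia.
rewrite [RHS]mulrDr; congr (_ + _).
have := sum_signs_cliques (A_graph D); rewrite natz => <-.
rewrite mulr_sumr [RHS]big_mkcondr /=.
apply: eq_bigr => T /set0Pn[e eT].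
rewrite coef_bracket_term; have [/forallP cl|/negP ncl] := boolP (@clique
  (A_graph D) T).
  rewrite (merges_clique conn adeq eT) ?subnn ?ltnn ?(coef_binomial _).1 ?mulr1
    //.
  move=> c cT; move: (cl c); rewrite cT /= => /forallP/(_ e); by rewrite eT.
have lt1 : (1 < merges T)%N.
  rewrite ltnNge; apply/negP => le1; apply: ncl.
  apply/forallP=> c; apply/implyP=> cT; apply/forallP=> f; apply/implyP=> fT.
  by apply: contraT => /(merges_nonclique conn adeq cT fT); rewrite ltnNge le1.
by rewrite lt1 mulr0.
Qed.
End BracketPolynomial.

(** * The first Betti number of the reduced A-graph *)

(** The kernel of the transposed boundary map consists of the functions that
    are constant on components, here the constants. *)
Lemma betti1_connected (G : multigraph) (x0 : vertex G) :
    (forall u : vertex G -> rat, (forall e, u (src e) = u (tgt e)) ->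
       forall x y, u x = u y) ->
  (betti1 G + #|vertex G| = #|edge G| + 1)%N.
Proof.
move=> connG; pose B := boundary G;
  pose one : 'rV[rat]_#|vertex G| := const_mx 1.
have coboundary (w : 'rV[rat]_#|vertex G|) i :
    (w *m B^T) 0 i = w 0 (enum_rank (tgt (enum_val i)))
                     - w 0 (enum_rank (src (enum_val i))).
  have pick x : \sum_j w 0 j * (x == enum_val j)%:R = w 0 (enum_rank x).
    rewrite (bigD1 (enum_rank x)) //= enum_rankK eqxx mulr1 big1 ?addr0 // =>
      j jx.
    rewrite (_ : x == _ = false) ?mulr0 //; apply: contra_neqF jx => /eqP->.
    by rewrite enum_valK.
  rewrite mxE -!pick -sumrB; apply: eq_bigr => j _.
  by rewrite !mxE mulrBr.
have ker1 : (kermx B^T :=: one)%MS.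
  apply/eqmxP/andP; split; last first.
    by apply/sub_kermxP/rowP=> i; rewrite coboundary !mxE subrr.
  apply/row_subP=> r; set w := row r _.
  have wB : w *m B^T = 0 by rewrite -row_mul mulmx_ker row0.
  have wc : forall x y, w 0 (enum_rank x) = w 0 (enum_rank y).
    apply: connG => e; apply/eqP; rewrite eq_sym -subr_eq0.
    by have := coboundary w (enum_rank e); rewrite wB mxE enum_rankK => <-.
  have -> : w = w 0 (enum_rank x0) *: one.
    apply/rowP=> j; rewrite -(enum_valK j) (wc (enum_val j) x0).
    by rewrite [RHS]mxE [X in _ = _ * X]mxE mulr1.
  exact: scalemx_sub.
have rank1 : \rank one = 1%N.
  rewrite rank_rV (_ : one != 0) //; apply/eqP=> /rowP/(_ (enum_rank x0))/eqP.
  by rewrite !mxE oner_eq0.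
have := mxrank_ker B^T; rewrite ker1 rank1 mxrank_tr => rkB.
rewrite /betti1 mxrank_ker -/B.
have := rank_leq_row B.
by move: (\rank B) rkB; lia.
Qed.

Section AGraph.
Variable D : link_diagram.
Hypothesis conn : diagram_connected D.

(** The loops met at one crossing are joined by its trace, and the diagram is
    connected. *)
Lemma A_graph_connected (A : eqType) (u : loop (A_state D) -> A) :
    (forall c : edge (A_graph D), u (src c) = u (tgt c)) ->
  forall x y, u x = u y.
Proof.
move=> edge_u.
have udart x y : u (loop_of (A_state D) x) = u (loop_of (A_state D) y).
  have : connect (map_link (@Defs.arc D)) x y.
    apply: (elimT (n_comp_le1P (map_link_sym (@arcK D)))).
    by rewrite -conn leq_addr.
  apply: (connect_invariant (phi := fun x => u (loop_of (A_state D) x))) =>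
    {x y} x y.
  have uconn z w : connect (state_link (A_state D)) z w ->
      u (loop_of (A_state D) z) = u (loop_of (A_state D) w).
    by rewrite -eq_loop_of => /eqP->.
  case/orP=> /eqP->; first by apply/uconn/connect_arc.
  case: x => c i.
  have e02 := edge_u c; rewrite /= in e02.
  have e0 : u (loop_of (A_state D) (c, 1%R)) = u (loop_of (A_state D) (c, 0%R)).
    have := splice_ends (A_state D) c; rewrite inE => -[<- _].
    by apply/esym/uconn/connect_splice.
  have e2 : u (loop_of (A_state D) (c, 3%R)) = u (loop_of (A_state D) (c, 2%R)).
    have := splice_ends (A_state D) c; rewrite inE => -[_ <-].
    by apply/esym/uconn/connect_splice.
  have all_u j : u (loop_of (A_state D) (c, j)) = u (loop_of (A_state D) (c,
    0%R)).
    by move: j; apply: ord4_ind; rewrite ?e0 ?e2 -?e02.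
  by rewrite /ccw /= !all_u.
have dartE (L : {L | L \in dart_loops (A_state D)}) : exists x, inl L = loop_of
  (A_state D) x.
  case: L => L DL; have [x _ Lx] := imsetP DL; exists x.
  by congr inl; apply: val_inj.
have c1 : (circles D <= 1)%N by rewrite -conn leq_addl.
have c0 (x : dart (crossing D)) : circles D = 0%N.
  have := conn; rewrite /diagram_connected.
  have : (0 < map_components (@Defs.arc D))%N.
    apply/card_gt0P; exists (fingraph.root (map_link (@Defs.arc D)) x).
    by rewrite !inE (roots_root (map_link_sym (@arcK D))).
  by lia.
case=> [L|i] [M|j].
- by have [x ->] := dartE L; have [y ->] := dartE M; apply: udart.
- by have [x _] := dartE L; have := leq_trans (ltn_ord j) (eq_leq (c0 x)).
- by have [x _] := dartE M; have := leq_trans (ltn_ord i) (eq_leq (c0 x)).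
- have -> // : i = j; apply: val_inj.
  have := leq_trans (ltn_ord i) c1; have := leq_trans (ltn_ord j) c1.
  by rewrite !ltnS !leqn0 => /eqP j0 /eqP i0; rewrite /= i0 j0.
Qed.

Lemma betti1_reduced_A_graph :
  (betti1 (reduction (A_graph D)) + #|loop (A_state D)|
     = #|edge (reduction (A_graph D))| + 1)%N.
Proof.
have /card_gt0P[x0 _] := card_loop_gt0 conn (A_state D).
apply: (@betti1_connected (reduction (A_graph D)) x0) => u edge_u.
apply: A_graph_connected => c.
have [r kr] := kept_representative c.
have ur := edge_u (exist (fun e => kept_edge e) r kr).
case/orP=> /andP[/eqP E1 /eqP E2].
  exact: etrans (congr1 u E1) (etrans ur (esym (congr1 u E2))).
exact: etrans (congr1 u E1) (etrans (esym ur) (esym (congr1 u E2))).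
Qed.
End AGraph.

(** * The Jones polynomial and its first two coefficients *)

Local Notation q := t_quarter.

Lemma t_quarter_neq0 : q != 0.
Proof. by rewrite /t_quarter tofrac_eq0 polyX_eq0. Qed.

(** Substitution of [t = q ^+ 4] for the variable. *)
Definition eval_t (p : {poly int}) : ratfun := tofrac (p \Po 'X^4).

Lemma eval_t_sum (I : finType) (F : I -> {poly int}) :
  eval_t (\sum_i F i) = \sum_i eval_t (F i).
Proof. by rewrite /eval_t !rmorph_sum. Qed.

Lemma eval_tM p r : eval_t (p * r) = eval_t p * eval_t r.
Proof. by rewrite /eval_t !rmorphM. Qed.

Lemma eval_tXn p n : eval_t (p ^+ n) = eval_t p ^+ n.
Proof. by rewrite /eval_t !rmorphXn. Qed.

Lemma eval_tX : eval_t 'X = q ^+ 4.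
Proof. by rewrite /eval_t comp_polyX rmorphXn. Qed.

Lemma eval_tC (c : int) : eval_t c%:P = c%:~R.
Proof. by rewrite /eval_t comp_polyC -[c in LHS]intz !rmorph_int. Qed.

Lemma eval_t_1X : eval_t (1 + 'X) = 1 + q ^+ 4.
Proof. by rewrite -eval_tX /eval_t rmorphD rmorph1 rmorphD rmorph1. Qed.

(** The lowest exponents on both sides agree, as both constant coefficients are
    nonzero. *)
Lemma laurent_unique (a : int) (p r : {poly int}) :
  q ^ a * tofrac p = tofrac r -> p`_0 != 0 -> r`_0 != 0 -> p = r.
Proof.
have pos n (p1 r1 : {poly int}) : q ^+ n * tofrac p1 = tofrac r1 -> r1`_0 != 0
  -> p1 = r1.
  rewrite /t_quarter -rmorphXn -rmorphM => /eqP; rewrite tofrac_eq => /eqP <-.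
  by case: n => [|n]; rewrite ?expr0 ?mul1r // coefXnM eqxx.
case: a => n E p0 r0; first exact: pos E r0.
apply/esym/(pos n.+1) => //; rewrite -E mulrA NegzE.
by rewrite exprnP -expfzDr ?t_quarter_neq0 // subrr expr0z mul1r.
Qed.

Lemma eval_t_unique (a : int) (p r : {poly int}) :
  q ^ a * eval_t p = eval_t r -> p`_0 != 0 -> r`_0 != 0 -> p = r.
Proof.
have coef4 (s : {poly int}) i : (s \Po 'X^4)`_(i * 4) = s`_i.
  by rewrite coef_comp_poly_Xn // dvdn_mull // mulnK.
move=> /laurent_unique E p0 r0.
have {E} E : p \Po 'X^4 = r \Po 'X^4.
  by apply: E; rewrite -(mul0n 4) coef4.
by apply/polyP=> i; rewrite -[LHS]coef4 -[RHS]coef4 E.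
Qed.

Lemma signz (F : fieldType) (z : int) : exists b : bool, (-1) ^ z = (-1) ^+ b
  :> F.
Proof.
exists (odd `|z|%N); rewrite signr_odd; case: z => n //=.
by rewrite NegzE -exprnN invr_sign. 
Qed.

(** With [n] crossings, [s] loops in the A-state, [j] B-splicings, [l.+1] loops
    and [m] merges, a state contributes a power of [x] that depends on [n] and
    [s] only, times a polynomial in [x ^+ 4]. *)
Lemma state_weight (F : fieldType) (x : F) (n s j l m : nat) :
    x != 0 -> (l.+1 + m.*2 = s + j)%N ->
  x^-1 ^ (n%:Z - j%:Z - j%:Z) * (- x^-1 ^+ 2 - x^-1 ^- 2) ^+ l
    = x ^ (2 - 2 * s%:Z - n%:Z)
      * ((-1) ^+ l * ((x ^+ 4) ^+ m * (1 + x ^+ 4) ^+ l)).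
Proof.
move=> x0 lmsj.
have -> : - x^-1 ^+ 2 - x^-1 ^- 2 = - 1 * (x ^ (- 2%:Z) * (1 + x ^+ 4)).
  by rewrite -exprnN; field; rewrite x0 oner_eq0.
rewrite [in LHS]exprMn [in LHS]exprMn [LHS]mulrCA [RHS]mulrCA; congr (_ * _).
rewrite !mulrA; congr (_ * _).
rewrite exprz_inv -exprM [(x ^ _) ^+ _]exprnP [x ^+ _]exprnP exprz_exp
  -!expfzDr //.
by congr (_ ^ _); lia.
Qed.

Section Jones.
Variable D : link_diagram.
Hypothesis conn : diagram_connected D.
Local Notation v := (#|loop (A_state D)|).

Lemma kauffman_bracketE :
  kauffman_bracket D q^-1
  = q ^ (2 - 2 * v%:Z - #|crossing D|%:Z) * eval_t (bracket_poly D).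
Proof.
rewrite /kauffman_bracket (reindex_inj (@setC_inj _)) /bracket_poly eval_t_sum
  mulr_sumr.
apply: eq_bigr => T _; have q0 := t_quarter_neq0.
rewrite /bracket_term !eval_tM !eval_tXn eval_tX eval_t_1X setCK.
have -> : eval_t (-1) = -1 by rewrite /eval_t !rmorphN1.
have -> : #|~: T|%:Z = #|crossing D|%:Z - #|T|%:Z by have := cardsC T; lia.
apply: state_weight => //.
by rewrite prednK ?(card_loop_gt0 conn) // mergesE.
Qed.

Lemma jonesE (o : orientation D) : exists (b : bool) (a : int),
  jones o = q ^ a * eval_t ((-1) ^+ b * bracket_poly D).
Proof.
have [b sgn] := signz ratfun (- writhe o).
exists b, (- 3%:Z * - writhe o + (2 - 2 * v%:Z - #|crossing D|%:Z)).
rewrite /jones kauffman_bracketE (expfzDr (- 3%:Z * - writhe o))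
  ?t_quarter_neq0 // eval_tM.
rewrite [in RHS]eval_tXn (_ : eval_t (-1) = -1);
  last by rewrite /eval_t !rmorphN1.
rewrite -[- q ^- 3]mulN1r expfzMl sgn exprnN exprz_exp.
by rewrite -mulrA [RHS]mulrCA -!mulrA.
Qed.
End Jones.

(* [h] is twice the exponent k, so that t^(k+i) = (t^(1/2))^(h + 2 i). *)
Theorem proposition3p1 (D : link_diagram) (o : orientation D)
    (D_conn : diagram_connected D) (D_adeq : A_adequate D)
    (h : int) (d : nat) (V : nat -> int)
    (V_first : V 0%N <> 0) (V_last : V d <> 0)
    (V_jones : jones o =
       \sum_(i < d.+1) (V i)%:~R * t_half ^ (h + 2 * (i : nat)%:Z)) :
  let V0 := V 0%N in
  let V1 := if (1 <= d)%N then V 1%N else 0 in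
  let G' := reduction (A_graph D) in
  [/\ V0 = 1 \/ V0 = -1,
      V1 * V0 <= 0,
      `|V1| = #|edge G'|%:Z - #|vertex G'|%:Z + 1
    & #|edge G'|%:Z - #|vertex G'|%:Z + 1 = (betti1 G')%:Z].
Proof.
move=> V0 V1 G'.
pose W : {poly int} := \poly_(i < d.+1) V i.
have W0 : W`_0 = V0 by rewrite coef_poly.
have W1 : W`_1 = V1 by rewrite coef_poly.
have VW : jones o = q ^ (2 * h) * eval_t W.
  rewrite V_jones /W poly_def eval_t_sum mulr_sumr; apply: eq_bigr => i _.
  rewrite -mul_polyC eval_tM eval_tC eval_tXn eval_tX mulrCA; congr (_ * _).
  rewrite /t_half -exprM [q ^+ 2]exprnP [q ^+ (4 * i)]exprnP exprz_exp -expfzDr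
    ?t_quarter_neq0 //.
  by congr (_ ^ _); lia.
have [b [a Ja]] := jonesE D_conn o.
pose P := (-1) ^+ b * bracket_poly D.
have PE i : P`_i = (-1) ^+ b * (bracket_poly D)`_i.
  by rewrite /P -(rmorph_sign polyC) coefCM.
have P_W : P = W.
  apply: (@eval_t_unique (a - 2 * h)).
  - rewrite expfzDr ?t_quarter_neq0 // mulrAC -Ja VW mulrAC -expfzDr
    ?t_quarter_neq0 //.
    by rewrite subrr expr0z mul1r.
  - by rewrite PE bracket_poly_coef0 // -exprD signr_eq0.
  - by rewrite W0; apply/eqP.
have betti := betti1_reduced_A_graph D_conn.
have [sg V0E V1E] : exists2 sg : bool, V0 = (-1) ^+ sg
    & V1 = (-1) ^+ sg * - (betti1 G')%:Z.
  exists (odd (b + #|loop (A_state D)|.-1)); rewrite signr_odd exprD.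
    by rewrite -W0 -P_W PE bracket_poly_coef0.
  rewrite -W1 -P_W PE bracket_poly_coef1 // mulrA; congr (_ * _).
  by move: betti; rewrite -/G'; lia.
have bettiE : #|edge G'|%:Z - #|vertex G'|%:Z + 1 = (betti1 G')%:Z.
  by move: betti; rewrite -/G' [vertex G']/=; lia.
rewrite bettiE; split=> //.
- by rewrite V0E; case: sg {V0E V1E}; [right|left].
- by rewrite V1E V0E mulrAC -expr2 sqrr_sign mul1r oppr_le0.
- by rewrite V1E normrMsign normrN.
Qed.
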